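(* Let $d\ge 1$ and let $f:[0,1]^d\to[0,1]$ be a continuous function with graph $G(f)=\{(x,f(x)):x\in[0,1]^d\}\subset[0,1]^{d+1}$. Then $\mu(G(f))=0$ for every isotropic doubling measure $\mu$ on $[0,1]^{d+1}$.
   Context: A rectangular box in $\mathbb{R}^{n}$ is an isometric image (arbitrary orientation allowed) of a product $\prod_{i=1}^{n}[0,\ell_i]$ with all $\ell_i>0$. A Borel measure $\mu$ on $[0,1]^{n}$ is isotropic doubling if there is a constant $A\ge 1$ such that $A^{-1}\le \mu(R_1)/\mu(R_2)\le A$ whenever $R_1,R_2\subset[0,1]^{n}$ are congruent rectangular boxes with nonempty intersection; it is understood that $0<\mu(R)<\infty$ for every rectangular box $R\subset[0,1]^n$. *)

(* Defs.v *)
From HB Require Import structures.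
From mathcomp Require Import all_boot all_order all_algebra.
From mathcomp Require Import all_classical all_reals all_analysis.

Set Implicit Arguments.
Unset Strict Implicit.
Unset Printing Implicit Defensive.

Import Order.TTheory GRing.Theory Num.Theory.
Import numFieldNormedType.Exports.

Local Open Scope classical_set_scope.
Local Open Scope ring_scope.

(* The library norm on 'rV[R]_n is the sup norm, which induces the right
   topology but not the right isometries; hence an explicit distance. *)
Definition edist (R : realType) (n : nat) (x y : 'rV[R]_n) : R :=
  Num.sqrt (\sum_(i < n) (x 0 i - y 0 i) ^+ 2).

Definition euclidean_isometry (R : realType) (n : nat)
    (phi : 'rV[R]_n -> 'rV[R]_n) : Prop :=
  forall x y, edist (phi x) (phi y) = edist x y.

Definition congruent (R : realType) (n : nat) (A B : set 'rV[R]_n) : Prop :=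
  exists2 phi, euclidean_isometry phi & phi @` A = B.

Definition std_box (R : realType) (n : nat) (l : 'I_n -> R) : set 'rV[R]_n :=
  [set x | forall i, 0 <= x 0 i <= l i].

Definition rectangular_box (R : realType) (n : nat) (B : set 'rV[R]_n) : Prop :=
  exists2 l : 'I_n -> R, (forall i, 0 < l i) & congruent (std_box l) B.

Definition unit_cube (R : realType) (n : nat) : set 'rV[R]_n :=
  std_box (fun=> 1).

(* [0,1]^n as a topological space of its own, with the topology induced
   from R^n. *)
Definition cube (R : realType) (n : nat) : Type := set_type (@unit_cube R n).

HB.instance Definition _ (R : realType) (n : nat) :=
  Topological.on (cube R n).

Lemma cube_origin (R : realType) (n : nat) :
  (0 : 'rV[R]_n) \in @unit_cube R n.
Proof. by rewrite inE => i; rewrite mxE lexx ler01. Qed.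

(* The library's measurable types must be pointed. *)
HB.instance Definition _ (R : realType) (n : nat) :=
  isPointed.Build (cube R n) (exist _ 0 (cube_origin R n)).

Definition borel_cube (R : realType) (n : nat) :=
  g_sigma_algebraType (@open (cube R n)).

(* a set of points of R^n, seen as a set of points of [0,1]^n *)
Definition in_cube (R : realType) (n : nat) (A : set 'rV[R]_n) :
    set (borel_cube R n) :=
  [set p | A (\val p)].

Definition isotropic_doubling (R : realType) (n : nat)
    (mu : {measure set (borel_cube R n) -> \bar R}) : Prop :=
  (forall B, rectangular_box B -> B `<=` @unit_cube R n ->
     (0 < mu (in_cube B) < +oo)%E) /\
  (exists2 A : R, 1 <= A &
     forall B1 B2 : set 'rV[R]_n,
       rectangular_box B1 -> rectangular_box B2 ->
       B1 `<=` @unit_cube R n -> B2 `<=` @unit_cube R n ->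
       congruent B1 B2 -> B1 `&` B2 !=set0 ->
       A^-1 <= fine (mu (in_cube B1)) / fine (mu (in_cube B2)) <= A).

Definition graph (R : realType) (d : nat) (f : cube R d -> R) :
    set 'rV[R]_(d + 1) :=
  [set row_mx (\val x) (f x)%:M | x in [set: cube R d]].

(* Main.v *)
Require Import Defs.
From HB Require Import structures.
From mathcomp Require Import all_boot all_order all_algebra.
From mathcomp Require Import all_classical all_reals all_analysis.
From mathcomp Require Import ring lra zify.

(** The graph is covered by columns [Q x J], where [Q] runs over the cells of a
    grid on [0,1]^d and [J] is an interval of length [h] containing [f @` Q];
    uniform continuity of [f] on the compact cube makes this possible for every
    [h], at the price of choosing the grid fine in terms of [h].  Nothing bounds
    the eccentricity of these columns: it is for them that doubling is needed on
    rectangular boxes and not merely on cubes.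

    Fix [Q].  Translating [Q x J] vertically by its height gives a congruent
    column that touches it, and two such steps lead to a column disjoint from
    [Q x J] whose measure is at least [A^-2 mu (Q x J)].  Hence tripling [J]
    multiplies the measure by at least [q = 1 + A^-2] (lemma [column_triple]),
    with the same [q > 1] for every base [Q].  Iterating, [mu (Q x J)] is at
    most [q^-k mu (Q x [0,1])] as soon as [h] is about [3^-k] (lemma
    [column_decay]).

    It remains to sum over [Q].  The closed columns [Q x [0,1]] overlap along
    faces, but those whose grid indices have prescribed parities are pairwise
    disjoint; as there are [2^d] parity classes, the sum is at most [2^d] times
    the total mass (lemma [sum_grid_columns_le]).  Thus the graph has measure at
    most [2^d q^-k mu([0,1]^(d+1))] for every [k]. *)

Set Implicit Arguments.
Unset Strict Implicit.
Unset Printing Implicit Defensive.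

Import Order.TTheory GRing.Theory Num.Theory.
Import numFieldNormedType.Exports.

Local Open Scope classical_set_scope.
Local Open Scope ring_scope.

(** * Axis-parallel boxes *)

Definition box (R : realType) n (a l : 'rV[R]_n) : set 'rV[R]_n :=
  [set x | forall i, a 0 i <= x 0 i <= a 0 i + l 0 i].

Lemma box_translate (R : realType) n (a b l : 'rV[R]_n) :
  (fun x => x + (b - a)) @` box a l = box b l.
Proof.
apply/seteqP; split=> [_ [x xal <-] i|y ybl].
  by have := xal i; rewrite !mxE; lra.
exists (y - (b - a)); last by rewrite subrK.
by move=> i; have := ybl i; rewrite !mxE; lra.
Qed.

Lemma box_congruent (R : realType) n (a b l : 'rV[R]_n) :
  congruent (box a l) (box b l).
Proof.
exists (fun x => x + (b - a)); last exact: box_translate.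
by move=> x y; congr Num.sqrt; apply: eq_bigr => i _; rewrite !mxE; ring.
Qed.

Lemma std_boxE (R : realType) n (l : 'rV[R]_n) : std_box (l 0) = box 0 l.
Proof. by apply/seteqP; split=> x + i => /(_ i); rewrite mxE add0r. Qed.

Lemma box_rectangular (R : realType) n (a l : 'rV[R]_n) :
  (forall i, 0 < l 0 i) -> rectangular_box (box a l).
Proof.
by move=> l0; exists (l 0) => //; rewrite std_boxE; exact: box_congruent.
Qed.

Lemma box_measurable (R : realType) n (a l : 'rV[R]_n) :
  measurable (in_cube (box a l)).
Proof.
have -> : in_cube (box a l) =
    ~` ((\val : cube R n -> 'rV[R]_n) @^-1` ~` box a l) :> set (borel_cube R n).
  by rewrite -preimage_setC setCK.
apply: measurableC; apply: sub_sigma_algebra => /=.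
apply: (proj1 (@continuousP (cube R n) _ _)); first exact: initial_continuous.
apply: closed_openC.
have -> : box a l = \bigcap_(i in [set: 'I_n])
    (fun x : 'rV[R]_n => x 0 i) @^-1` `[a 0 i, a 0 i + l 0 i].
  apply/seteqP; split=> x /=; first by move=> xal i _ /=; rewrite in_itv/=.
  by move=> xal i; have := xal i I; rewrite /= in_itv.
apply: closed_bigI => i _; apply: preimage_closed.
  by move=> x _; exact: coord_continuous.
exact: itv_closed.
Qed.

(** * Uniform continuity on the cube *)

Lemma cube_compact (R : realType) n : compact (@unit_cube R n).
Proof.
have := @rV_compact R n (fun=> [set` `[0, 1]]) (fun=> @segment_compact R 0 1).
congr compact; apply/seteqP; split=> x + i => /(_ i); rewrite /= in_itv//.
Qed.

Definition cube_point (R : realType) n (x : 'rV[R]_n) (x01 : unit_cube x) :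
  cube R n := exist _ x (mem_set x01).

(** Heine-Cantor.  The modulus is expressed coordinatewise and as the inverse of
    an integer so that it can serve as the mesh of a grid. *)
Lemma cube_unif_continuous (R : realType) d (f : cube R d -> R) (e : R) :
  continuous f -> 0 < e -> exists2 N, (0 < N)%N &
    forall x y : cube R d,
      (forall j, `|\val x 0 j - \val y 0 j| <= N%:R^-1) -> `|f x - f y| <= e.
Proof.
move=> f_cont e0.
have /compact_near_coveringP/near_covering_withinP cov := @cube_compact R d.
pose P N (u : 'rV[R]_d) := forall x y : cube R d, \val x = u ->
  (forall j, `|\val x 0 j - \val y 0 j| <= N.+1%:R^-1) -> `|f x - f y| <= e.
have : \forall N \near \oo, @unit_cube R d `<=` P N.
  apply: cov => u cu.
  pose p := cube_point cu.
  (* With [ball u r] inside the neighbourhood on which [f] varies by less than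
     [e / 2], everything within [r / 2] of a point of [ball u (r / 2)] stays in
     [ball u r]. *)
  have := f_cont p _ (nbhsx_ballx (f p) (e / 2) ltac:(by rewrite divr_gt0)).
  case=> _ [[W Wo <-] /= Wu WP].
  have /nbhs_ballP[r /= r0 ballW] : nbhs u W by apply: open_nbhs_nbhs.
  have r20 : 0 < r / 2 by rewrite divr_gt0.
  near=> v N => /= cv x y xv xy.
  have r2 : N.+1%:R^-1 < r / 2.
    by near: N; exact: near_infty_natSinv_lt (PosNum r20).
  have uv : ball u (r / 2) v by near: v; exact: nbhsx_ballx.
  have fx : `|f p - f x| < e / 2.
    apply: WP => /=; apply: ballW.
    by rewrite -xv in uv; apply: le_ball uv; lra.
  have fy : `|f p - f y| < e / 2.
    apply: WP => /=; apply: ballW.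
    rewrite [r]splitr; rewrite -xv in uv.
    apply: ball_triangle uv _; split=> // i j; rewrite ord1.
    by exact: le_lt_trans (xy j) r2.
  rewrite (_ : f x - f y = (f p - f y) - (f p - f x)); last by ring.
  by apply: le_trans (ler_normB _ _) _; lra.
case=> N _ /(_ N (leqnn N)) PN; exists N.+1 => // x y; apply: PN => //.
exact/set_mem/(valP x).
Unshelve. all: by end_near.
Qed.

(** * Columns *)

Definition column (R : realType) d (c s : 'rV[R]_d) (a h : R) :
    set 'rV[R]_(d + 1) :=
  box (row_mx c a%:M) (row_mx s h%:M).

Lemma columnE (R : realType) d (c s : 'rV[R]_d) a h z :
  column c s a h z <->
    box c s (lsubmx z) /\ a <= z 0 (rshift d 0) <= a + h.
Proof.
split=> [zc|[zl zr] i].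
  split=> [j|]; first by have := zc (lshift 1 j); rewrite !row_mxEl mxE.
  by have := zc (rshift d 0); rewrite !row_mxEr !mxE !mulr1n.
case: (split_ordP i) => j ->; first by have := zl j; rewrite !row_mxEl mxE.
by rewrite !row_mxEr !mxE (ord1 j) !mulr1n.
Qed.

Lemma column_measurable (R : realType) d (c s : 'rV[R]_d) a h :
  measurable (in_cube (column c s a h)).
Proof. exact: box_measurable. Qed.

Lemma column_subset (R : realType) d (c s : 'rV[R]_d) a h a' h' :
  a' <= a -> a + h <= a' + h' -> column c s a h `<=` column c s a' h'.
Proof. by move=> ? ? z /columnE[? ?]; apply/columnE; split=> //; lra. Qed.

Lemma column_unit (R : realType) d (c s : 'rV[R]_d) :
  box c s `<=` @unit_cube R d -> column c s 0 1 `<=` @unit_cube R (d + 1).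
Proof.
move=> cs z /columnE[/cs zl zr] i.
case: (split_ordP i) => j ->; first by have := zl j; rewrite mxE.
by rewrite (ord1 j); lra.
Qed.

(** * Decay of the measure of a column with its height *)

Lemma isotropic_doubling_fin (R : realType) n
    (mu : {measure set (borel_cube R n) -> \bar R}) :
  isotropic_doubling mu -> fin_num_fun mu.
Proof.
case=> mu_fin _; apply: lty_fin_num_fun.
have cube_rect : rectangular_box (@unit_cube R n).
  exists (fun=> 1) => [_|]; first exact: ltr01.
  by exists id => //; rewrite image_id.
have /andP[_] := mu_fin _ cube_rect (@subset_refl _ _).
congr (mu _ < _)%E; apply/seteqP; split=> // x _.
exact/set_mem/(valP x).
Qed.

Lemma doubling_translates (R : realType) n
    (mu : {measure set (borel_cube R n) -> \bar R}) :
  isotropic_doubling mu -> exists2 A : R, 0 < A &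
    forall a b l : 'rV[R]_n, (forall i, 0 < l 0 i) ->
      box a l `<=` @unit_cube R n -> box b l `<=` @unit_cube R n ->
      box a l `&` box b l !=set0 ->
      fine (mu (in_cube (box a l))) <= A * fine (mu (in_cube (box b l))).
Proof.
case=> mu_pos [A A1 dbl]; exists A; first by rewrite (lt_le_trans ltr01).
move=> a b l l0 al bl ab.
have [ra rb] := (box_rectangular a l0, box_rectangular b l0).
have /andP[_] := dbl _ _ ra rb al bl (box_congruent a b l) ab.
by rewrite ler_pdivrMr// fine_gt0// mu_pos.
Qed.

(** The constant [q] is uniform in the base, however thin, because the columns
    compared are vertical translates of one another.  The two conclusions let an
    interval be tripled upwards or downwards. *)
Lemma column_triple (R : realType) d
    (mu : {measure set (borel_cube R (d + 1)) -> \bar R}) :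
  isotropic_doubling mu -> exists2 q : R, 1 < q &
    forall (c s : 'rV[R]_d) a h, (forall i, 0 < s 0 i) ->
      box c s `<=` @unit_cube R d -> 0 < h -> 0 <= a -> a + 3 * h <= 1 ->
      let m x y := fine (mu (in_cube (column c s x y))) in
      q * m a h <= m a (3 * h) /\ q * m (a + 2 * h) h <= m a (3 * h).
Proof.
move=> mu_dbl; have mu_fin := isotropic_doubling_fin mu_dbl.
have [A A0 dbl] := doubling_translates mu_dbl.
exists (1 + (A * A)^-1); first by rewrite ltrDl invr_gt0 mulr_gt0.
move=> c s a h s0 cs h0 a0 a1 m.
have sub x : 0 <= x -> x + h <= 1 -> column c s x h `<=` @unit_cube R _.
  move=> x0 x1; apply: subset_trans (column_unit cs).
  by apply: column_subset; rewrite ?add0r.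
have touch x y : 0 <= x -> x + h <= 1 -> 0 <= y -> y + h <= 1 ->
    `|x - y| = h -> m x h <= A * m y h.
  move=> x0 x1 y0 y1 xy; apply: dbl; [|exact: sub|exact: sub|].
    move=> i; case: (split_ordP i) => j ->; first by rewrite row_mxEl.
    by rewrite row_mxEr mxE (ord1 j) mulr1n.
  exists (row_mx c (Num.max x y)%:M).
  have cc : box c s c by move=> j; have := s0 j; lra.
  by split; apply/columnE; rewrite row_mxKl row_mxEr mxE mulr1n; split=> //;
    move: xy; rewrite maxEle; case: (ler0P (x - y)); case: (leP x y); lra.
(* Translates by [h] touch, translates by [2 * h] are disjoint: the middle
   third serves as the intermediate step between the outer two. *)
have le1 : m a h <= A * (A * m (a + 2 * h) h).
  apply: le_trans (touch a (a + h) _ _ _ _ _) _; try lra.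
    by rewrite ler0_norm; lra.
  rewrite ler_pM2l//; apply: touch; try lra.
  by rewrite ler0_norm; lra.
have le2 : m (a + 2 * h) h <= A * (A * m a h).
  apply: le_trans (touch _ (a + h) _ _ _ _ _) _; try lra.
    by rewrite ger0_norm; lra.
  rewrite ler_pM2l//; apply: touch; try lra.
  by rewrite ger0_norm; lra.
have sum_le : m a h + m (a + 2 * h) h <= m a (3 * h).
  have mC := @column_measurable R d c s.
  rewrite /m -fineD ?mu_fin// -measureU//; last first.
    rewrite -subset0 => p [/columnE[_ ?] /columnE[_ ?]]; lra.
  apply: fine_le; rewrite ?mu_fin//; first exact: measurableU.
  apply: le_measure; rewrite ?inE//; first exact: measurableU.
  move=> p [] /=; apply: column_subset; lra.
have {}le1 : (A * A)^-1 * m a h <= m (a + 2 * h) h.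
  by rewrite ler_pdivrMl ?mulr_gt0// -mulrA.
have {}le2 : (A * A)^-1 * m (a + 2 * h) h <= m a h.
  by rewrite ler_pdivrMl ?mulr_gt0// -mulrA.
by split; rewrite mulrDl mul1r; lra.
Qed.

(** The interval [a, a + h] can be tripled inside [0, 1], upwards or downwards,
    as long as [5 * h <= 1]: if [1 < a + 3 * h], then [2 * h <= a].  The
    hypothesis on [k] allows for [k] successive triplings. *)
Lemma column_decay (R : realType) d
    (mu : {measure set (borel_cube R (d + 1)) -> \bar R}) :
  isotropic_doubling mu -> exists2 q : R, 1 < q &
    forall (c s : 'rV[R]_d) k a h, (forall i, 0 < s 0 i) ->
      box c s `<=` @unit_cube R d -> 0 < h -> 0 <= a -> a + h <= 1 ->
      5 * 3 ^+ k * h <= 1 ->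
      ((q ^+ k)%:E * mu (in_cube (column c s a h)) <=
       mu (in_cube (column c s 0 1)))%E.
Proof.
move=> mu_dbl; have mu_fin := isotropic_doubling_fin mu_dbl.
have [q q1 triple] := column_triple mu_dbl; exists q => // c s k a h s0 cs.
have mC := @column_measurable R d c s.
rewrite -(fineK (mu_fin _ (mC a h))) -(fineK (mu_fin _ (mC 0 1))).
rewrite -EFinM lee_fin.
elim: k a h => [|k IH] a h h0 a0 a1 hk.
  rewrite expr0 mul1r; apply: fine_le; rewrite ?mu_fin//.
  by apply: le_measure; rewrite ?inE// => p; apply: column_subset; lra.
have h5 : 5 * h <= 1.
  apply: le_trans hk; rewrite ler_pM2r// ler_peMr//.
  by rewrite exprn_ege1//; lra.
have hk' : 5 * 3 ^+ k * (3 * h) <= 1 by move: hk; rewrite exprS; lra.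
suff [b [b0 b1 qb]] : exists b, [/\ 0 <= b, b + 3 * h <= 1 &
    q * fine (mu (in_cube (column c s a h))) <=
    fine (mu (in_cube (column c s b (3 * h))))].
  apply: le_trans (IH b (3 * h) _ b0 b1 hk'); last by lra.
  by rewrite exprSr -mulrA ler_pM2l// exprn_gt0//; lra.
have [a3|a3] := leP (a + 3 * h) 1.
  exists a; split=> //.
  by have [] := triple c s a h s0 cs h0 a0 a3.
exists (a - 2 * h); split; [lra|lra|].
have [] := triple c s (a - 2 * h) h s0 cs h0; [lra|lra|].
by rewrite subrK.
Qed.

(** * The grid *)

Definition cell_corner (R : realType) d N (i : {ffun 'I_d -> 'I_N}) :
    'rV[R]_d :=
  \row_j ((i j)%:R / N%:R).

Definition cell_side (R : realType) d N : 'rV[R]_d := const_mx N%:R^-1.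

Definition grid_cell (R : realType) d N (i : {ffun 'I_d -> 'I_N}) :
    set 'rV[R]_d :=
  box (cell_corner R i) (cell_side R d N).

Lemma grid_cellE (R : realType) d N (i : {ffun 'I_d -> 'I_N}) (x : 'rV[R]_d) :
  (0 < N)%N ->
  grid_cell i x <-> forall j, (i j)%:R <= N%:R * x 0 j <= (i j).+1%:R.
Proof.
move=> N0; have N0' : 0 < N%:R :> R by rewrite ltr0n.
split=> + j => /(_ j); rewrite !mxE -[X in _ + X]mul1r -mulrDl natr1;
  by rewrite ler_pdivrMr// ler_pdivlMr// mulrC.
Qed.

Lemma grid_cell_unit (R : realType) d N (i : {ffun 'I_d -> 'I_N}) :
  (0 < N)%N -> grid_cell i `<=` @unit_cube R d.
Proof.
move=> N0 x /grid_cellE -/(_ N0) xi j; have /andP[lo hi] := xi j.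
have N0' : 0 < N%:R :> R by rewrite ltr0n.
rewrite -(pmulr_rge0 _ N0') (le_trans _ lo)//= -(ler_pM2l N0') mulr1.
by rewrite (le_trans hi)// ler_nat ltn_ord.
Qed.

Lemma grid_cover (R : realType) d N (x : 'rV[R]_d) :
  (0 < N)%N -> unit_cube x -> exists i : {ffun 'I_d -> 'I_N}, grid_cell i x.
Proof.
move=> N0 x01; have N0' : 0 < N%:R :> R by rewrite ltr0n.
have /fin_all_exists[i xi] j :
    exists k : 'I_N, k%:R <= N%:R * x 0 j <= k.+1%:R.
  have /andP[x0 x1] := x01 j.
  have [xN|xN] := ltP (N%:R * x 0 j) N%:R.
    have Nx0 : 0 <= N%:R * x 0 j by rewrite mulr_ge0// ltW.
    have /andP[lo hi] := truncn_itv Nx0.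
    have kN : (Num.truncn (N%:R * x 0%R j) < N)%N.
      by rewrite -(ltr_nat R) (le_lt_trans lo).
    by exists (Ordinal kN); rewrite /= lo ltW.
  (* The right end [x 0 j = 1] belongs to the last cell. *)
  have kN : (N.-1 < N)%N by rewrite prednK.
  exists (Ordinal kN) => /=; rewrite prednK//.
  rewrite (le_trans _ xN) ?ler_nat ?leq_pred//=.
  by rewrite ler_piMr// ltW.
by exists [ffun j => i j]; apply/grid_cellE => // j; rewrite ffunE.
Qed.

(** Intersecting closed cells have indices that differ by at most one in each
    coordinate. *)
Lemma grid_cell_disjoint (R : realType) d N (i k : {ffun 'I_d -> 'I_N}) :
  (0 < N)%N -> (forall j, odd (i j) = odd (k j)) ->
  @grid_cell R d N i `&` grid_cell k !=set0 -> i = k.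
Proof.
move=> N0 ik [x [/grid_cellE -/(_ N0) xi /grid_cellE -/(_ N0) xk]].
apply/ffunP => j; apply/val_inj => /=.
have /andP[ilo ihi] := xi j; have /andP[klo khi] := xk j.
have : (i j)%:R <= (k j).+1%:R :> R by exact: le_trans ilo khi.
have : (k j)%:R <= (i j).+1%:R :> R by exact: le_trans klo ihi.
rewrite !ler_nat; have := ik j.
by case: ltngtP => //; lia.
Qed.

(** The columns of one parity class are pairwise disjoint, so each of the [2^d]
    classes contributes at most the total mass. *)
Lemma sum_grid_columns_le (R : realType) d N
    (mu : {measure set (borel_cube R (d + 1)) -> \bar R}) :
  fin_num_fun mu -> (0 < N)%N ->
  (\sum_(i : {ffun 'I_d -> 'I_N})
     mu (in_cube (column (cell_corner R i) (cell_side R d N) 0 1)) <=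
   ((2 ^ d)%:R : R)%:E * mu setT)%E.
Proof.
move=> mu_fin N0.
pose F (i : {ffun 'I_d -> 'I_N}) :=
  in_cube (column (cell_corner R i) (cell_side R d N) 0 1).
pose parity (i : {ffun 'I_d -> 'I_N}) := [ffun j => odd (i j)].
have mF i : measurable (F i) by exact: column_measurable.
rewrite (partition_big parity xpredT)//=.
apply: (@le_trans _ _ (\sum_(c : {ffun 'I_d -> bool}) mu setT)%E); last first.
  rewrite -[mu setT]fineK ?mu_fin// sumEFin sumr_const.
  by rewrite card_ffun card_bool card_ord -EFinM mulr_natl.
apply: lee_sum => c _.
rewrite bigfs ?index_enum_uniq//; last by move=> i; rewrite mem_index_enum.
have disj : trivIset [set` [pred i | true && (parity i == c)]] F.
  move=> i k /= /eqP ic /eqP kc [p [/columnE[pi _] /columnE[pk _]]].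
  apply: (@grid_cell_disjoint R d N) => //.
    move=> j; move: (etrans ic (esym kc)).
    by move=> /(congr1 (fun g : {ffun _} => g j)); rewrite !ffunE.
  by exists (lsubmx (\val p)).
rewrite -(@measure_fin_bigcup _ _ _ mu _ _ F)//.
by apply: le_measure; rewrite ?inE//; exact: fin_bigcup_measurable.
Qed.

(** * The graph *)

(** The graph is closed: it is the zero set of the continuous function
    sending [p] to the value of [f] below [p] minus the height of [p]. *)
Lemma graph_measurable (R : realType) d (f : cube R d -> R) :
  continuous f -> measurable (in_cube (graph f)).
Proof.
move=> f_cont.
have base_cube (p : cube R (d + 1)) : unit_cube (lsubmx (\val p)).
  by move=> j; rewrite mxE; exact: (set_mem (valP p)).
pose base (p : cube R (d + 1)) : cube R d := cube_point (base_cube p).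
pose gap (p : cube R (d + 1)) := f (base p) - (\val p) 0 (rshift d 0).
have -> : in_cube (graph f) = ~` (gap @^-1` ~` [set 0]) :> set (borel_cube R _).
  rewrite -preimage_setC setCK; apply/seteqP; split=> p /=.
    case=> x _ xp; rewrite /gap.
    have -> : base p = x by apply/val_inj; rewrite /= -xp row_mxKl.
    by rewrite -xp row_mxEr mxE mulr1n subrr.
  move/subr0_eq => fp; exists (base p) => //.
  rewrite fp /= -[RHS]hsubmxK; congr row_mx.
  by rewrite [RHS]mx11_scalar mxE.
apply: measurableC; apply: sub_sigma_algebra => /=.
apply: (proj1 (@continuousP (cube R (d + 1)) R gap)); last first.
  by apply: closed_openC; exact: closed_eq.
have val_cont : continuous (\val : cube R (d + 1) -> 'rV[R]_(d + 1)).
  exact: initial_continuous.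
have base_cont : continuous base.
  move=> p A [_ [[W Wo <-] Wp WA]].
  have /nbhs_ballP[r /= r0 ballW] : nbhs (lsubmx (\val p)) W.
    exact: open_nbhs_nbhs.
  have : nbhs p ((\val : cube R (d + 1) -> _) @^-1` ball (\val p) r).
    exact: (val_cont p _ (nbhsx_ballx (\val p) r r0)).
  rewrite /fmap/=; apply: filterS => q [_ pq].
  apply: WA; apply: ballW; split=> // i j.
  by rewrite !mxE; exact: pq.
have height_cont :
    continuous (fun p : cube R (d + 1) => (\val p) 0 (rshift d 0)).
  move=> p; exact: (continuous_comp (val_cont p)
    (@coord_continuous R 1 (d + 1) 0 (rshift d 0) (\val p))).
move=> p; have fb := continuous_comp (base_cont p) (f_cont (base p)).
exact: (cvgB fb (height_cont p)).
Qed.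

Lemma geometric_bound_le0 (R : realType) (q g M : R) :
  1 < q -> (forall k, q ^+ k * g <= M) -> g <= 0.
Proof.
move=> q1 bound; have q0 : 0 < q by lra.
have lim0 : (fun k => M * q^-1 ^+ k) @ \oo --> (0 : R).
  rewrite -[X in _ --> X](mulr0 M); apply: cvgMr.
  by apply: cvg_expr; rewrite ger0_norm ?invr_ge0 ?invf_lt1// ltW.
rewrite -(cvg_lim _ lim0)//; apply: limr_ge; first by apply/cvg_ex; exists 0.
by apply: nearW => k; rewrite exprVn ler_pdivlMr ?exprn_gt0// mulrC.
Qed.

Theorem proposition2p4 (R : realType) (d : nat) (hd : (1 <= d)%N)
    (f : cube R d -> R) (f_cont : continuous f)
    (f01 : forall x, 0 <= f x <= 1)
    (mu : {measure set (borel_cube R (d + 1)) -> \bar R})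
    (mu_doubling : isotropic_doubling mu) :
  mu (in_cube (graph f)) = 0%E.
Proof.
have mu_fin := isotropic_doubling_fin mu_doubling.
have mG := graph_measurable f_cont.
have [q q1 decay] := column_decay mu_doubling.
apply/eqP; rewrite -measure_le0 -[leLHS]fineK ?mu_fin// lee_fin.
apply: (geometric_bound_le0 (M := (2 ^ d)%:R * fine (mu setT)) q1) => k.
rewrite -lee_fin !EFinM !fineK ?mu_fin//.
have pow3 : 1 <= 3 ^+ k :> R by rewrite exprn_ege1//; lra.
pose h : R := (5 * 3 ^+ k)^-1.
have hk : 5 * 3 ^+ k * h = 1 by rewrite mulfV//; lra.
have h0 : 0 < h by rewrite invr_gt0; lra.
have h1 : h <= 1 by nra.
have [N N0 osc] := cube_unif_continuous f_cont (divr_gt0 h0 (ltr0Sn R 1)).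
have Np : 0 < N%:R^-1 :> R by rewrite invr_gt0 ltr0n.
have side0 j : 0 < cell_side R d N 0 j by rewrite mxE.
have corner_cell (i : {ffun 'I_d -> 'I_N}) : grid_cell i (cell_corner R i).
  by move=> j; have := side0 j; lra.
pose corner i := cube_point (grid_cell_unit N0 (corner_cell i)).
(* The interval of length [h] centred at [f (corner i)], pushed back into
   [0, 1]; it still contains every value of [f] within [h / 2] of the centre
   since these values lie in [0, 1]. *)
pose low i := Num.max 0 (Num.min (f (corner i) - h / 2) (1 - h)).
have low0 i : 0 <= low i by rewrite le_max lexx.
have low1 i : low i + h <= 1.
  by rewrite /low maxEle minEle; case: ifP; case: ifP; lra.
pose C (i : {ffun 'I_d -> 'I_N}) := column (cell_corner R i) (cell_side R d N).
have mC i a l : measurable (in_cube (C i a l)) by exact: column_measurable.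
have cover : in_cube (graph f) `<=`
    \bigcup_(i in [set` xpredT]) in_cube (C i (low i) h).
  move=> p [x _ xp].
  have [i xi] := grid_cover N0 (set_mem (valP x)).
  exists i => //=; rewrite /in_cube/= -xp; apply/columnE.
  rewrite row_mxKl row_mxEr mxE mulr1n; split=> //.
  have : `|f x - f (corner i)| <= h / 2.
    apply: osc => j /=; have := xi j; have := corner_cell i j.
    rewrite [cell_side _ _ _ _ _]mxE ler_norml; lra.
  have := f01 x; have := f01 (corner i); rewrite ler_norml /low maxEle minEle.
  by case: ifP; case: ifP; lra.
have graph_le : (mu (in_cube (graph f)) <=
    \sum_(i : {ffun 'I_d -> 'I_N}) mu (in_cube (C i (low i) h)))%E.
  rewrite bigfs ?index_enum_uniq//; last by move=> i; rewrite mem_index_enum.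
  exact: content_sub_fsum.
apply: le_trans (sum_grid_columns_le mu_fin N0).
apply: (@le_trans _ _ ((q ^+ k)%:E *
    \sum_(i : {ffun 'I_d -> 'I_N}) mu (in_cube (C i (low i) h)))%E).
  by rewrite lee_pmul2l// lte_fin exprn_gt0//; lra.
rewrite ge0_sume_distrr//; apply: lee_sum => i _.
apply: decay => //; last by rewrite hk.
exact: grid_cell_unit.
Qed.
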